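(* Let $m \geq 1$ be an integer and let $q \in \mathbb{C}$ be any primitive $N$th root of unity. Then $$\sum_{N-1 \geq n_{2m-1} \geq \cdots \geq n_1 \geq 0} (-q^{n_1+1})_{n_{2m-1}-n_1} (-1)^{n_{2m-1}} (q)_{n_1} \prod_{i=1}^{2m-2} q^{n_i^2+n_i} \begin{bmatrix} n_{i+1} \\ n_i \end{bmatrix}$$ $$= \sum_{N-1 \geq n_m \geq \cdots \geq n_1 \geq 0} (-q^{2n_1+2})_{2n_m-2n_1}(-1)^{n_m}q^{-(n_m+1)^2}(q^2;q^2)_{n_1} \prod_{i=1}^{m-1} q^{2n_i^2+2n_i} \begin{bmatrix} n_{i+1} \\ n_i \end{bmatrix}_{q^2},$$ where the first sum runs over integer tuples $(n_1,\dots,n_{2m-1})$ and the second over integer tuples $(n_1,\dots,n_m)$ satisfying the displayed inequalities.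
   Context: For a non-negative integer $n$, $(a;q)_n = \prod_{k=0}^{n-1}(1-aq^k)$, and $(a)_n$ denotes $(a;q)_n$; $(q^2;q^2)_n=\prod_{k=1}^n(1-q^{2k})$. The $q$-binomial coefficient (Gaussian polynomial) is $\begin{bmatrix} n \\ k \end{bmatrix} = \begin{bmatrix} n \\ k \end{bmatrix}_q = \frac{(q)_n}{(q)_{n-k}(q)_k}$ if $0 \leq k \leq n$ and $0$ otherwise; it is a polynomial in $q$, and at a root of unity it means the value of this polynomial. $\begin{bmatrix} n \\ k \end{bmatrix}_{q^2}$ is the same polynomial with $q$ replaced by $q^2$. Empty products equal $1$. *)

(* Defs.v *)
From HB Require Import structures.
From mathcomp Require Import all_boot all_order all_algebra.
From mathcomp Require Import reals complex ring.

Set Implicit Arguments.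
Unset Strict Implicit.
Unset Printing Implicit Defensive.

Import GRing.Theory.
Local Open Scope ring_scope.

Definition qpoch (A : comNzRingType) (a q : A) (n : nat) : A :=
  \prod_(k < n) (1 - a * q ^+ k).

(* The Gaussian polynomial, an element of F[X]; the Euclidean quotient is an
   exact one by [qbinomE].  The q-binomial coefficient at x is
   [(qbinom F n k).[x]], also when x is a root of unity. *)
Definition qbinom (F : fieldType) (n k : nat) : {poly F} :=
  if (k <= n)%N then
    qpoch 'X 'X n %/ (qpoch 'X 'X (n - k) * qpoch 'X 'X k)
  else 0.

(* Entries of a tuple, numbered from 1: [part t 1, ..., part t l]. *)
Definition part (N l : nat) (t : l.-tuple 'I_N) (i : nat) : nat :=
  nth 0%N [seq val x | x <- t] i.-1.

Definition nondecreasing_tuple (N l : nat) (t : l.-tuple 'I_N) : bool :=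
  sorted leq [seq val x | x <- t].

Lemma qpochS (A : comNzRingType) (a q : A) n :
  qpoch a q n.+1 = qpoch a q n * (1 - a * q ^+ n).
Proof. by rewrite /qpoch big_ord_recr. Qed.

Lemma qpochX_neq0 (F : fieldType) n : qpoch 'X 'X n != 0 :> {poly F}.
Proof.
elim: n => [|n IHn]; first by rewrite /qpoch big_ord0 oner_eq0.
rewrite qpochS mulf_neq0 // -exprS; apply/eqP => /(congr1 (horner^~ 0)).
by move/eqP; rewrite !hornerE expr0n subr0 oner_eq0.
Qed.

Lemma qpoch_dvd (A : comNzRingType) (q : A) a b :
  exists G, qpoch q q (a + b) = G * (qpoch q q a * qpoch q q b).
Proof.
elim: a b => [|a IHa] b.
  by exists 1; rewrite /qpoch big_ord0 !mul1r.
elim: b => [|b [G2 E2]].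
  by exists 1; rewrite addn0 /qpoch big_ord0 mulr1 mul1r.
have [G1 E1] := IHa b.+1.
exists (G1 + q ^+ a.+1 * G2).
have -> : (a.+1 + b.+1 = (a.+1 + b).+1)%N by rewrite addnS.
rewrite qpochS -exprS.
have -> : 1 - q ^+ (a.+1 + b).+1
  = (1 - q ^+ a.+1) + q ^+ a.+1 * (1 - q ^+ b.+1).
  by rewrite mulrBr mulr1 -exprD addnS addrA subrK.
rewrite mulrDr {1}addSnnS E1 E2 (qpochS _ _ a) (qpochS _ _ b) -!exprS.
by ring.
Qed.

Lemma qbinomE (F : fieldType) n k : (k <= n)%N ->
  qbinom F n k * (qpoch 'X 'X (n - k) * qpoch 'X 'X k) = qpoch 'X 'X n.
Proof.
move=> le_kn; rewrite /qbinom le_kn divpK //.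
have [G E] := @qpoch_dvd {poly F} 'X (n - k) k.
by rewrite subnK // in E; rewrite E dvdp_mull.
Qed.

(* Main.v *)
Require Import Defs.
From HB Require Import structures.
From mathcomp Require Import all_boot all_order all_algebra.
From mathcomp Require Import reals complex ring zify.

Set Implicit Arguments.
Unset Strict Implicit.
Unset Printing Implicit Defensive.

Import Order.TTheory GRing.Theory Num.Theory.
Local Open Scope ring_scope.

(** Freeze the largest index of each sum, call it n, and sum over the others.
    The inner sums are values of two recursively defined polynomials in q,
    written P_l(n) for the first side ([lhs_chain]) and Q_i(n) for the second
    ([rhs_chain]), and the claim becomes
      sum_(n < N) (-1)^n P_(2m-2)(n)
        = sum_(n < N) (-1)^n q^(-(n+1)^2) Q_(m-1)(n).

    For q not a root of unity, P_l(n) / (q^2;q^2)_n and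
    Q_i(n) / ((-q)_(2n+1) (q^2;q^2)_n) are the second members of Bailey pairs,
    in base q and base q^2 respectively.  One more summation multiplies the
    first member alpha_r by q^(r^2+r) in base q ([bailey_pair_step]), hence by
    q^(2(r^2+r)) in base q^2: two steps on one side amount to one step on the
    other.  The matrix g = [base_change] multiplies alpha_r by q^(-r(r+1)/2)
    while passing from base q^2 to base q ([bailey_pair_base_change]), a change
    of base in the sense of Bressoud, Ismail and Stanton.  All these operations
    are diagonal on alpha, so they commute; since g also carries Q_0 to P_0
    ([sum_base_change_entry]),
      q^(n(n+1)/2) P_(2i)(n) = sum_(k <= n) g(n,k) Q_i(k)
    ([chain_base_change]).  Both sides are polynomials in q, so this holds at
    roots of unity too.

    It remains to sum over n with weight (-1)^n q^(-n(n+1)/2).  The column sums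
    of g are given by a terminating q-Vandermonde sum, and are
    (-1)^k q^(-(k+1)^2) ([sum_base_change_alternating]): exactly the weight of
    the second side.  Column k of g is supported on k <= n <= 2k+1, which may
    exceed the range n < N.  If N is odd, g(n,k) vanishes for k < N <= n at a
    primitive N-th root of unity.  If N is even it does not, but then q^(N/2)
    and q^(3N/2) are both -1, which makes P_l(n) and Q_i(n) vanish for n >= N,
    and all sums may be taken up to 2N instead ([sum_lhs_rhs_chain]). *)

(** * Gaussian coefficients *)

(** Gaussian coefficients by Pascal's rule: this form makes sense over any
    commutative ring and is preserved by ring morphisms, which is what moving
    identities between a generic q and a root of unity requires. *)
Fixpoint gauss (A : comNzRingType) (q : A) (n k : nat) : A :=
  match n, k with
  | _, 0 => 1
  | 0, _.+1 => 0
  | n'.+1, k'.+1 => gauss q n' k' + q ^+ k'.+1 * gauss q n' k'.+1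
  end.

Lemma gauss0r (A : comNzRingType) (q : A) n : gauss q n 0 = 1.
Proof. by case: n. Qed.

Lemma gaussSS (A : comNzRingType) (q : A) n k :
  gauss q n.+1 k.+1 = gauss q n k + q ^+ k.+1 * gauss q n k.+1.
Proof. by []. Qed.

Lemma gauss_small (A : comNzRingType) (q : A) n k :
  (n < k)%N -> gauss q n k = 0.
Proof.
elim: n k => [|n IHn] [|k] //= lt_nk.
by rewrite !IHn ?mulr0 ?addr0 //; lia.
Qed.

Lemma qpoch0 (A : comNzRingType) (a q : A) : qpoch a q 0 = 1.
Proof. by rewrite /qpoch big_ord0. Qed.

Lemma qpochD (A : comNzRingType) (a q : A) m n :
  qpoch a q (m + n) = qpoch a q m * qpoch (a * q ^+ m) q n.
Proof.
elim: n => [|n IHn]; first by rewrite addn0 qpoch0 mulr1.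
by rewrite addnS !qpochS IHn -!mulrA -exprD.
Qed.

Lemma gauss_qpoch (A : comNzRingType) (q : A) n k :
  gauss q (n + k) k * (qpoch q q n * qpoch q q k) = qpoch q q (n + k).
Proof.
elim: n k => [|n IHn] k.
  elim: k => [|k IHk]; first by rewrite qpoch0 /= !mul1r.
  rewrite add0n gaussSS (@gauss_small _ _ k k.+1) // mulr0 addr0 qpochS.
  by move: IHk; rewrite add0n qpoch0 !mul1r mulrA => ->.
elim: k => [|k IHk]; first by rewrite gauss0r addn0 qpoch0 mulr1 mul1r.
have := IHn k.+1; rewrite addnS => En.
rewrite addSn addnS gaussSS mulrDl.
rewrite [X in X + _](_ : _ = (1 - q ^+ k.+1) * qpoch q q (n + k).+1).
  rewrite [X in _ + X](_ : _ =
    q ^+ k.+1 * (1 - q ^+ n.+1) * qpoch q q (n + k).+1).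
    rewrite [in RHS]qpochS -exprS.
    have -> : q ^+ (n + k).+2 = q ^+ k.+1 * q ^+ n.+1.
      by rewrite -exprD; congr (_ ^+ _); lia.
    by ring.
  by rewrite -En (qpochS _ _ n) -exprS; ring.
by rewrite addSn in IHk; rewrite -IHk (qpochS _ _ k) -exprS; ring.
Qed.

Lemma rmorph_qpoch (A B : comNzRingType) (f : {rmorphism A -> B}) (a q : A) n :
  f (qpoch a q n) = qpoch (f a) (f q) n.
Proof.
rewrite /qpoch rmorph_prod; apply: eq_bigr => k _.
by rewrite rmorphB rmorph1 rmorphM rmorphXn.
Qed.

Lemma rmorph_gauss (A B : comNzRingType) (f : {rmorphism A -> B}) (q : A) n k :
  f (gauss q n k) = gauss (f q) n k.
Proof.
elim: n k => [|n IHn] [|k] /=; rewrite ?rmorph1 ?rmorph0 //.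
by rewrite rmorphD rmorphM rmorphXn !IHn.
Qed.

Lemma qbinom_horner (F : fieldType) (x : F) n k :
  (qbinom F n k).[x] = gauss x n k.
Proof.
have [le_kn|lt_nk] := leqP k n; last first.
  by rewrite /qbinom leqNgt lt_nk /= horner0 gauss_small.
suff -> : qbinom F n k = gauss 'X n k.
  have := rmorph_gauss (horner_eval x) 'X n k.
  by rewrite /= /horner_eval hornerX.
have nz : qpoch 'X 'X (n - k) * qpoch 'X 'X k != 0 :> {poly F}.
  by rewrite mulf_neq0 ?qpochX_neq0.
apply: (mulIf nz); rewrite qbinomE //.
by have := gauss_qpoch ('X : {poly F}) (n - k) k; rewrite subnK.
Qed.

(** * Chains of summations *)

(** A sum over nondecreasing tuples whose largest entry n is left free: adding an
    entry above is then one more application of the kernel, the operation that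
    Bailey pairs diagonalize. *)
Fixpoint chain (A : comNzRingType) (h : nat -> A) (K : nat -> nat -> A)
    (l n : nat) : A :=
  if l is l'.+1 then \sum_(k < n.+1) K n k * chain h K l' k else h n.

Lemma chainSr (A : comNzRingType) (h : nat -> A) K l n :
  chain h K l.+1 n = chain (fun n => \sum_(k < n.+1) K n k * h k) K l n.
Proof.
by elim: l n => [|l IHl] n //=; apply: eq_bigr => k _; rewrite -IHl.
Qed.

Lemma sum_widen (A : comNzRingType) (u : nat -> A) n N :
  (n <= N)%N -> (forall k, (n <= k)%N -> u k = 0) ->
  \sum_(k < n) u k = \sum_(k < N) u k.
Proof.
move=> le_nN u0; rewrite (big_ord_widen_cond N xpredT) //.
rewrite [RHS](bigID (fun k : 'I__ => (k < n)%N)) /=.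
by rewrite [X in _ + X]big1 ?addr0 // => k; rewrite -leqNgt => /u0.
Qed.

Lemma rmorph_chain (A B : comNzRingType) (f : {rmorphism A -> B})
    (h : nat -> A) (K : nat -> nat -> A) h' K' l n :
  (forall n, f (h n) = h' n) -> (forall n k, f (K n k) = K' n k) ->
  f (chain h K l n) = chain h' K' l n.
Proof.
move=> fh fK; elim: l n => [|l IHl] n //=.
by rewrite rmorph_sum; apply: eq_bigr => k _; rewrite rmorphM fK IHl.
Qed.

(** The factor (-q^(n_1+1))_(n_last-n_1) depends on both ends of the tuple; it
    splits as a product over consecutive entries, so that one step of the
    chain carries its own share of it. *)
Definition lhs_kernel (A : comNzRingType) (q : A) n k :=
  q ^+ (k ^ 2 + k) * gauss q n k * qpoch (- q ^+ (k + 1)) q (n - k).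

Definition rhs_kernel (A : comNzRingType) (q : A) n k :=
  q ^+ (2 * k ^ 2 + 2 * k) * gauss (q ^+ 2) n k
  * qpoch (- q ^+ (2 * k + 2)) q (2 * n - 2 * k).

Definition lhs_chain (A : comNzRingType) (q : A) :=
  chain (qpoch q q) (lhs_kernel q).

Definition rhs_chain (A : comNzRingType) (q : A) :=
  chain (qpoch (q ^+ 2) (q ^+ 2)) (rhs_kernel q).

(** Generically this is
    (-1)^j q^(j(j-1)) (q)_(n+1) / ((q)_(n+1-2j) (q^2;q^2)_j) with j = n - k;
    since (q)_(2j) = (q;q^2)_j (q^2;q^2)_j, this equals the polynomial below,
    which also has a value at roots of unity. *)
Definition base_change (A : comNzRingType) (q : A) n k : A :=
  if (k <= n)%N then
    (-1) ^+ (n - k) * q ^+ ((n - k) * (n - k).-1)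
    * gauss q n.+1 (2 * (n - k)) * qpoch q (q ^+ 2) (n - k)
  else 0.

Lemma rmorph_lhs_chain (A B : comNzRingType) (f : {rmorphism A -> B}) (q : A)
    l n :
  f (lhs_chain q l n) = lhs_chain (f q) l n.
Proof.
apply: rmorph_chain => [{}n|{}n k]; first exact: rmorph_qpoch.
by rewrite !rmorphM rmorphXn rmorph_gauss rmorph_qpoch rmorphN rmorphXn.
Qed.

Lemma rmorph_rhs_chain (A B : comNzRingType) (f : {rmorphism A -> B}) (q : A)
    l n :
  f (rhs_chain q l n) = rhs_chain (f q) l n.
Proof.
apply: rmorph_chain => [{}n|{}n k]; first by rewrite rmorph_qpoch rmorphXn.
by rewrite !rmorphM !rmorphXn rmorph_gauss rmorph_qpoch rmorphN !rmorphXn.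
Qed.

Lemma rmorph_base_change (A B : comNzRingType) (f : {rmorphism A -> B}) (q : A)
    n k :
  f (base_change q n k) = base_change (f q) n k.
Proof.
rewrite /base_change; case: ifP => _; last exact: rmorph0.
rewrite !rmorphM !rmorphXn rmorph_gauss rmorph_qpoch rmorphN rmorph1.
by rewrite !rmorphXn.
Qed.

(** * Shift rules for inverse q-factorials *)

(** Away from roots of unity, all the q-factorials that occur in denominators
    are invertible. *)
Definition generic (K : fieldType) (q : K) :=
  q != 0 /\ forall n, q ^+ n.+1 != 1.

Lemma generic_sqr (K : fieldType) (q : K) : generic q -> generic (q ^+ 2).
Proof.
case=> q0 hq; split=> [|n]; first by rewrite expf_neq0.
by rewrite -exprM mul2n doubleS.
Qed.

Lemma generic_subr_neq0 (K : fieldType) (q : K) n :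
  generic q -> 1 - q ^+ n.+1 != 0.
Proof. by case=> _ hq; rewrite subr_eq0 eq_sym. Qed.

Lemma generic_addr_neq0 (K : fieldType) (q : K) n :
  generic q -> 1 + q ^+ n.+1 != 0.
Proof.
move=> /generic_sqr/(generic_subr_neq0 n); apply: contraNneq => h.
by rewrite -exprM mulnC exprM -[1 in X in X - _](expr1n _ 2) subr_sqr h mulr0.
Qed.

Lemma generic_qpoch_neq0 (K : fieldType) (q : K) n :
  generic q -> qpoch q q n != 0.
Proof.
move=> hq; rewrite /qpoch; apply/prodf_neq0 => i _.
by rewrite -exprS generic_subr_neq0.
Qed.

Lemma generic_qpochN_neq0 (K : fieldType) (q : K) n :
  generic q -> qpoch (- q) q n != 0.
Proof.
move=> hq; rewrite /qpoch; apply/prodf_neq0 => i _.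
by rewrite mulNr opprK -exprS generic_addr_neq0.
Qed.

Lemma qpoch_sqr (A : comNzRingType) (q : A) n :
  qpoch (q ^+ 2) (q ^+ 2) n = qpoch q q n * qpoch (- q) q n.
Proof.
elim: n => [|n IHn]; first by rewrite !qpoch0 mulr1.
by rewrite !qpochS IHn -exprM mulnC exprM; ring.
Qed.

(** 1 / (q)_(a-b), extended by 0 to negative index.  With this extension the
    shift rules [ipochSl] and [ipochSr] hold without side condition on a and b,
    so hypergeometric terms satisfy their recurrences up to and beyond the ends
    of their support, and the boundary terms of telescoping sums vanish. *)
Definition ipoch (K : fieldType) (q : K) (a b : nat) : K :=
  if (b <= a)%N then (qpoch q q (a - b))^-1 else 0.

Lemma ipochSS (K : fieldType) (q : K) a b :
  ipoch q a.+1 b.+1 = ipoch q a b.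
Proof. by []. Qed.

Lemma ipoch_small (K : fieldType) (q : K) a b :
  (a < b)%N -> ipoch q a b = 0.
Proof. by move=> lt_ab; rewrite /ipoch (leqNgt b) lt_ab. Qed.

(** Only the difference of the two indices matters, also when it is negative. *)
Lemma eq_ipoch (K : fieldType) (q : K) a b c d :
  (a + d = c + b)%N -> ipoch q a b = ipoch q c d.
Proof.
move=> e; rewrite /ipoch; have -> : (b <= a)%N = (d <= c)%N by lia.
by case: ifP => // _; congr (_ _)^-1; lia.
Qed.

Lemma ipochnn (K : fieldType) (q : K) a : ipoch q a a = 1.
Proof. by rewrite /ipoch leqnn subnn qpoch0 invr1. Qed.

Lemma ipochE (K : fieldType) (q : K) a b :
  ipoch q (a + b) b = (qpoch q q a)^-1.
Proof. by rewrite /ipoch leq_addl addnK. Qed.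

Lemma ipochSl (K : fieldType) (q : K) a b : generic q ->
  ipoch q a b = (1 - q ^+ a.+1 / q ^+ b) * ipoch q a.+1 b.
Proof.
move=> hq; have [q0 _] := hq.
have [le_ba|lt_ab] := leqP b a.
  rewrite -(subnK le_ba) -addSn !ipochE exprD mulfK ?expf_neq0 //.
  rewrite qpochS -exprS; field.
  by rewrite generic_qpoch_neq0 // generic_subr_neq0.
rewrite ipoch_small //; move: lt_ab; rewrite leq_eqVlt => /orP [/eqP <-|lt].
  by rewrite divff ?expf_neq0 // subrr mul0r.
by rewrite ipoch_small // mulr0.
Qed.

Lemma ipochSr (K : fieldType) (q : K) a b : generic q ->
  ipoch q a b.+1 = (1 - q ^+ a / q ^+ b) * ipoch q a b.
Proof.
move=> hq; case: a => [|a]; last first.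
  by rewrite ipochSS ipochSl.
case: b => [|b].
  by rewrite ipoch_small // divff ?subrr ?mul0r // oner_eq0.
by rewrite !ipoch_small // mulr0.
Qed.

Lemma gauss_ipoch (K : fieldType) (q : K) n k : generic q ->
  gauss q n k = qpoch q q n * ipoch q k 0 * ipoch q n k.
Proof.
move=> hq; have [le_kn|lt_nk] := leqP k n; last first.
  by rewrite gauss_small // (@ipoch_small _ q n k) // mulr0.
rewrite -(subnK le_kn) ipochE -gauss_qpoch /ipoch leq0n subn0 subnK //.
by field; rewrite !generic_qpoch_neq0.
Qed.

Lemma qpoch_double (A : comNzRingType) (q : A) n :
  qpoch q q (2 * n) = qpoch q (q ^+ 2) n * qpoch (q ^+ 2) (q ^+ 2) n.
Proof.
elim: n => [|n IHn]; first by rewrite !qpoch0 mulr1.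
rewrite mulnSr addn2 !qpochS IHn -!exprM -!exprS -!exprD mulnC.
by rewrite add2n mulnC; ring.
Qed.

Lemma gauss_even (K : fieldType) (q : K) n j : generic q ->
  gauss q n (2 * j) * qpoch q (q ^+ 2) j
  = qpoch q q n * ipoch q n (2 * j) * ipoch (q ^+ 2) j 0.
Proof.
move=> hq; rewrite gauss_ipoch // /ipoch !subn0 /= qpoch_double.
have nz2 : qpoch (q ^+ 2) (q ^+ 2) j != 0.
  exact: generic_qpoch_neq0 (generic_sqr hq).
have nz1 : qpoch q (q ^+ 2) j != 0.
  have := generic_qpoch_neq0 (2 * j) hq.
  by rewrite qpoch_double mulf_eq0 negb_or => /andP [].
by field; rewrite nz1 nz2.
Qed.

(** * The change of base on the bottom of the chains *)

(** The factor (-1)^(n-k) q^((n-k)(n-k-1)), written without truncated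
    subtraction so that [wsignSl] and [wsignSr] hold for all n and k. *)
Definition wsign (K : fieldType) (q : K) (n k : nat) : K :=
  (-1) ^+ (n + k) * q ^+ (n * n + k * k + k) / q ^+ (2 * n * k + n).

Lemma wsignE (K : fieldType) (q : K) n k : q != 0 -> (k <= n)%N ->
  wsign q n k = (-1) ^+ (n - k) * q ^+ ((n - k) * (n - k).-1).
Proof.
move=> q0 le_kn; rewrite /wsign -(subnK le_kn); move: (n - k)%N => j.
rewrite addnK -addnA addnn -mul2n exprD exprM sqrrN expr1n expr1n mulr1.
rewrite -mulrA; congr (_ * _); apply: (canLR (mulfK _)); first exact: expf_neq0.
rewrite -exprD; congr (_ ^+ _); case: j => [|j] /=; nia.
Qed.

Lemma wsignSl (K : fieldType) (q : K) n k : q != 0 ->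
  wsign q n.+1 k = - ((q ^+ n) ^+ 2 / (q ^+ k) ^+ 2) * wsign q n k.
Proof.
move=> q0; rewrite /wsign addSn exprS.
have -> : (n.+1 * n.+1 + k * k + k = (n * n + k * k + k) + (n * 2 + 1))%N.
  by lia.
have -> : (2 * n.+1 * k + n.+1 = (2 * n * k + n) + (k * 2 + 1))%N by lia.
rewrite !(exprD _ _ (_ * 2 + 1)) !(exprD _ _ 1) expr1 !(exprM _ _ 2).
by field; rewrite !expf_neq0 // q0.
Qed.

Lemma wsignSr (K : fieldType) (q : K) n k : q != 0 ->
  wsign q n k.+1 = - ((q ^+ k) ^+ 2 * q ^+ 2 / (q ^+ n) ^+ 2) * wsign q n k.
Proof.
move=> q0; rewrite /wsign addnS exprS.
have -> : (n * n + k.+1 * k.+1 + k.+1 = (n * n + k * k + k) + (k * 2 + 2))%N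
  by lia.
have -> : (2 * n * k.+1 + n = (2 * n * k + n) + n * 2)%N by lia.
rewrite (exprD _ _ (_ * 2 + 2)) (exprD _ _ (n * 2)) (exprD _ _ 2) !(exprM _ _ 2).
by field; rewrite !expf_neq0.
Qed.

Lemma sum_telescope_0 (K : fieldType) (u G : nat -> K) n :
  (forall k, u k = G k.+1 - G k) -> G 0 = 0 -> G n = 0 ->
  \sum_(0 <= k < n) u k = 0.
Proof.
move=> uG G0 Gn; rewrite (eq_bigr (fun k => G k.+1 - G k)) => [|k _ //].
by rewrite telescope_sumr // G0 Gn subrr.
Qed.

(** An entry of [base_change] up to the factor (q)_(n+1) / (q^2;q^2)_k that
    [base_changeE] records, in a form with simple shifts in n and k. *)
Definition base_change_entry (K : fieldType) (q : K) n k : K :=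
  wsign q n k * ipoch q (2 * k + 1) n * ipoch (q ^+ 2) n k
  * qpoch (q ^+ 2) (q ^+ 2) k.

Lemma ipoch_sqrSl (K : fieldType) (q : K) a b : generic q ->
  ipoch (q ^+ 2) a b
  = (1 - q ^+ 2 * (q ^+ a) ^+ 2 / (q ^+ b) ^+ 2) * ipoch (q ^+ 2) a.+1 b.
Proof.
move=> hq; rewrite ipochSl; last exact: generic_sqr.
by rewrite [_ ^+ a.+1]exprS !(exprAC q 2).
Qed.

Lemma ipoch_odd1 (K : fieldType) (q : K) n k : generic q ->
  ipoch q (2 * k) n
  = (1 - q * (q ^+ k) ^+ 2 / q ^+ n) * ipoch q (2 * k + 1) n.
Proof.
by move=> hq; rewrite ipochSl // addn1 exprS -exprM mulnC.
Qed.

Lemma ipoch_odd2 (K : fieldType) (q : K) n k : generic q ->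
  ipoch q (2 * k) n.+1
  = (1 - (q ^+ k) ^+ 2 / q ^+ n) * (1 - q * (q ^+ k) ^+ 2 / q ^+ n)
     * ipoch q (2 * k + 1) n.
Proof.
move=> hq; rewrite ipochSr // ipoch_odd1 // mulrA.
by rewrite -exprM mulnC.
Qed.

(** The change of base carries (q^2;q^2)_k, the bottom of the second chain, to
    (q)_n, the bottom of the first.  The sum S(n) is a terminating q-Vandermonde
    sum; it satisfies (1 - q^(n+2)) S(n+1) = q^(n+1) (1 - q^(n+1)) S(n), because
    the corresponding combination of summands is a difference G(k+1) - G(k). *)
Lemma sum_base_change_entry (K : fieldType) (q : K) n : generic q ->
  (1 - q ^+ n.+1) * \sum_(0 <= k < n.+1) base_change_entry q n k
  = q ^+ 'C(n.+1, 2).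
Proof.
move=> hq; have [q0 _] := hq.
elim: n => [|n IHn].
  rewrite big_nat1 /base_change_entry /wsign /= !expr0 expr1 qpoch0.
  rewrite ipochnn /ipoch /= /qpoch big_ord1 expr0 mulr1 !mul1r !mulr1 invr1 mul1r.
  by rewrite divff //; exact: (generic_subr_neq0 0 hq).
have qn0 : q ^+ n != 0 by rewrite expf_neq0.
rewrite binS bin1 exprD -IHn [in q ^+ n.+1]exprS.
(* The rational certificate of the recurrence, as q-Zeilberger's algorithm
   would give it. *)
pose G k := q ^+ 2 * (q ^+ n) ^+ 4 / (q ^+ k) ^+ 4 * wsign q n k
  * ipoch q (2 * k) n.+1 * ipoch (q ^+ 2) n.+1 k * qpoch (q ^+ 2) (q ^+ 2) k.
apply/eqP; rewrite -subr_eq0; apply/eqP.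
transitivity (\sum_(0 <= k < n.+2)
  ((1 - q ^+ n.+2) * base_change_entry q n.+1 k
    - q * q ^+ n * (1 - q ^+ n.+1) * base_change_entry q n k)).
  rewrite big_split /= -mulr_sumr sumrN -mulr_sumr; congr (_ - _).
  rewrite [in RHS]big_nat_recr //= [X in _ * (_ + X)](_ : _ = 0); last first.
    rewrite /base_change_entry (@ipoch_small _ (q ^+ 2)) //.
    by rewrite mulr0 mul0r.
  by rewrite addr0 [in RHS]exprS; ring.
apply: (@sum_telescope_0 _ _ G) => [k||].
- have qk0 : q ^+ k != 0 by rewrite expf_neq0.
  rewrite /base_change_entry /G (wsignSl _ _ q0) (wsignSr _ _ q0).
  have -> : (2 * k.+1 = (2 * k + 1).+1)%N by lia.
  rewrite ipochSS ipoch_odd2 // (@ipoch_sqrSl _ _ n k) // ipochSS.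
  rewrite (ipochSr (2 * k + 1)) //.
  rewrite (@ipoch_sqrSl _ _ n k) // qpochS -!exprM.
  rewrite ?[(2 * k)%N]mulnC addn1 !exprS !exprM.
  by field; rewrite ?q0 ?qn0 ?qk0.
- by rewrite /G ipoch_small // mulr0 !mul0r.
- by rewrite /G (@ipoch_small _ (q ^+ 2)) // mulr0 mul0r.
Qed.

(** * The change of base on the Bailey matrix *)

(** Entry n, k of the change of base times entry k, r of the matrix that defines
    Bailey pairs in base q^2. *)
Definition base_change_bailey_term (K : fieldType) (q : K) n r k : K :=
  base_change_entry q n k * qpoch (- q) q (2 * k + 1)
  * ipoch (q ^+ 2) k r * ipoch (q ^+ 2) (k + r + 1) 0.

(** The sum over k is a balanced 4phi3 series, and this is a contiguous
    relation that raises n by one in a single place, as an induction on n for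
    all r requires.  Again the combination of summands is a difference. *)
Lemma base_change_bailey_rec (K : fieldType) (q : K) n r : generic q ->
  (1 - q * q ^+ n.+1) * (1 - q ^+ 2 * (q ^+ n) ^+ 2 / (q ^+ r) ^+ 2)
    * \sum_(0 <= k < n.+2) base_change_bailey_term q n.+1 r k
  = q * q ^+ n * (1 + q * (q ^+ n) ^+ 2 / (q ^+ r) ^+ 2)
    * \sum_(0 <= k < n.+1) base_change_bailey_term q n r k
  + q ^+ 3 * (q ^+ n) ^+ 2 * (1 + q * (q ^+ r) ^+ 2)
    * \sum_(0 <= k < n.+1) base_change_bailey_term q n r.+1 k.
Proof.
move=> hq; have [q0 _] := hq.
have qn0 : q ^+ n != 0 by rewrite expf_neq0.
have qr0 : q ^+ r != 0 by rewrite expf_neq0.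
(* The rational certificate of the recurrence, as q-Zeilberger's algorithm
   would give it. *)
pose G k := q ^+ 2 * (q ^+ n) ^+ 4 / (q ^+ k) ^+ 4 * wsign q n k
  * ipoch q (2 * k) n.+1 * ipoch (q ^+ 2) n.+1 k * qpoch (q ^+ 2) (q ^+ 2) k
  * qpoch (- q) q (2 * k + 1) * ipoch (q ^+ 2) k r.+1
  * ipoch (q ^+ 2) (k + r + 1) 0.
have last0 s : base_change_bailey_term q n s n.+1 = 0.
  rewrite /base_change_bailey_term /base_change_entry (@ipoch_small _ _ n n.+1) //.
  by rewrite mulr0 !mul0r.
have widen s : \sum_(0 <= k < n.+1) base_change_bailey_term q n s k
    = \sum_(0 <= k < n.+2) base_change_bailey_term q n s k.
  by rewrite [in RHS]big_nat_recr //= last0 addr0.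
rewrite !widen; apply/eqP; rewrite -subr_eq0; apply/eqP.
rewrite !mulr_sumr -big_split -sumrB /=.
apply: (@sum_telescope_0 _ _ G) => [k||].
- have qk0 : q ^+ k != 0 by rewrite expf_neq0.
  rewrite /base_change_bailey_term /base_change_entry /G.
  rewrite (wsignSl _ _ q0) (wsignSr _ _ q0).
  have -> : (2 * k.+1 = (2 * k + 1).+1)%N by lia.
  rewrite ipochSS ipoch_odd2 // (@ipoch_sqrSl _ _ n k) // ipochSS.
  rewrite (ipochSr (2 * k + 1)) //.
  rewrite (@ipoch_sqrSl _ _ n k) // (qpochS _ _ k) !addn1 !qpochS ipochSS.
  rewrite (@ipochSr _ (q ^+ 2) k r); last exact: generic_sqr.
  rewrite addSn addnS (@ipoch_sqrSl _ _ (k + r).+1 0) //.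
  set i1 := ipoch q _ n; set i2 := ipoch _ n.+1 k; set i3 := ipoch _ k r.
  set i4 := ipoch _ _ 0.
  set p1 := qpoch (q ^+ 2) _ _; set p2 := qpoch (- q) _ _.
  rewrite !(exprAC q 2).
  have -> : q ^+ (k + r).+1 = q * q ^+ k * q ^+ r.
    by rewrite exprS exprD mulrA.
  have -> : q ^+ (2 * k).+1 = q * (q ^+ k) ^+ 2.
    by rewrite exprS mulnC exprM.
  have -> : q ^+ (2 * k).+2 = q ^+ 2 * (q ^+ k) ^+ 2.
    by rewrite 2!exprS mulnC exprM; ring.
  rewrite !(exprS q n) !(exprS q k) expr0.
  rewrite expr1n !divr1 !mulNr !opprK.
  move: qn0 qr0 qk0 (1 + q * q ^+ (2 * k)) (wsign q n k).
  move: (q ^+ n) (q ^+ k) (q ^+ r) => x y z x0 z0 y0 p3 s.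
  by field; rewrite q0 x0 y0 z0.
- by rewrite /G muln0 (@ipoch_small _ _ 0 n.+1) // mulr0 !mul0r.
- by rewrite /G (@ipoch_small _ _ n.+1 n.+2) // mulr0 !mul0r.
Qed.

Lemma sum_base_change_bailey_small (K : fieldType) (q : K) n r : (n < r)%N ->
  \sum_(0 <= k < n.+1) base_change_bailey_term q n r k = 0.
Proof.
move=> lt_nr; rewrite big_nat big1 // => k /andP [_ lt_kn].
rewrite /base_change_bailey_term (@ipoch_small _ _ k r) ?mulr0 ?mul0r //; lia.
Qed.

(** On the diagonal r = n a single summand survives. *)
Lemma sum_base_change_bailey_diag (K : fieldType) (q : K) n : generic q ->
  (1 - q ^+ n.+1) * \sum_(0 <= k < n.+1) base_change_bailey_term q n n k
  = qpoch (- q) q n * ipoch q (n + n).+1 0.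
Proof.
move=> hq; have [q0 _] := hq.
rewrite big_nat_recr //= big_nat big1 => [|k /andP [_ lt_kn]]; last first.
  by rewrite /base_change_bailey_term (@ipoch_small _ _ k n) // mulr0 mul0r.
rewrite add0r /base_change_bailey_term /base_change_entry wsignE // subnn mul0n.
rewrite !ipochnn !mul1r !mulr1 !addn1.
have -> : ipoch q (2 * n).+1 n = (qpoch q q n.+1)^-1.
  by rewrite -(ipochE q n.+1 n); congr (ipoch _ _ _); lia.
rewrite addnn -mul2n /ipoch !subn0 /= !qpoch_sqr !(qpochS q q n) -exprS.
by field; rewrite !generic_qpoch_neq0 ?generic_qpochN_neq0 ?generic_subr_neq0.
Qed.

(** The product of the change of base with the base q^2 Bailey matrix is the
    base q Bailey matrix times a diagonal one.  Both sides satisfy the recurrence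
    [base_change_bailey_rec], which determines the values at n+1 from those at n
    except for r = n+1, where its leading coefficient vanishes. *)
Lemma sum_base_change_bailey (K : fieldType) (q : K) n r : generic q ->
  (1 - q ^+ n.+1) * q ^+ 'C(r.+1, 2)
    * \sum_(0 <= k < n.+1) base_change_bailey_term q n r k
  = q ^+ 'C(n.+1, 2) * qpoch (- q) q n * ipoch q n r * ipoch q (n + r).+1 0.
Proof.
move=> hq; have [q0 _] := hq.
have diag m : (1 - q ^+ m.+1) * q ^+ 'C(m.+1, 2)
    * \sum_(0 <= k < m.+1) base_change_bailey_term q m m k
  = q ^+ 'C(m.+1, 2) * qpoch (- q) q m * ipoch q m m * ipoch q (m + m).+1 0.
  by rewrite ipochnn mulr1 -[RHS]mulrA -sum_base_change_bailey_diag //; ring.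
elim: n r => [|n IHn] r; last first.
  have [lt_nr|] := ltnP n.+1 r.
    rewrite sum_base_change_bailey_small // (@ipoch_small _ _ n.+1 r) //.
    by rewrite !mulr0 mul0r.
  rewrite leq_eqVlt => /orP [/eqP -> //|le_rn].
  have qn0 : q ^+ n != 0 by rewrite expf_neq0.
  have qr0 : q ^+ r != 0 by rewrite expf_neq0.
  have nzr : 1 - q ^+ 2 * (q ^+ n) ^+ 2 / (q ^+ r) ^+ 2 != 0.
    have -> : q ^+ 2 * (q ^+ n) ^+ 2 / (q ^+ r) ^+ 2 = (q ^+ 2) ^+ (n - r).+1.
      have -> : q ^+ n = q ^+ (n - r) * q ^+ r by rewrite -exprD subnK.
      rewrite [_ ^+ (n - r).+1]exprS !(exprAC q 2).
      by move: (q ^+ (n - r)) (q ^+ r) qr0 => x z z0; field.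
    exact: generic_subr_neq0 (generic_sqr hq).
  have nz1 : 1 - q ^+ n.+1 != 0 by exact: generic_subr_neq0.
  apply: (mulfI nzr); apply: (mulfI nz1).
  have rec := base_change_bailey_rec n r hq.
  have := IHn r; have := IHn r.+1; move: rec.
  set S := \sum_(_ <= _ < n.+2) _; set S0 := \sum_(_ <= _ < n.+1) _.
  set S1 := \sum_(_ <= _ < n.+1) _ => rec IH1 IH0.
  transitivity (q * q ^+ n * (1 + q * (q ^+ n) ^+ 2 / (q ^+ r) ^+ 2)
      * ((1 - q ^+ n.+1) * q ^+ 'C(r.+1, 2) * S0)
    + q ^+ 3 * (q ^+ n) ^+ 2 * (1 + q * (q ^+ r) ^+ 2) / q ^+ r.+1
      * ((1 - q ^+ n.+1) * q ^+ 'C(r.+2, 2) * S1)).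
    transitivity ((1 - q ^+ n.+1) * q ^+ 'C(r.+1, 2)
      * ((1 - q * q ^+ n.+1) * (1 - q ^+ 2 * (q ^+ n) ^+ 2 / (q ^+ r) ^+ 2) * S)).
      by rewrite -exprS; ring.
    rewrite rec (binS r.+1) bin1 exprD !exprS; move: (q ^+ r) qr0 => z z0.
    by field; rewrite q0 z0.
  rewrite IH0 IH1 (binS n.+1) bin1 exprD (qpochS _ _ n) mulNr opprK -exprS.
  rewrite addSn addnS (@ipochSr _ _ n r) // (ipochSl n r) //.
  rewrite (ipochSl (n + r).+1 0) // expr0 divr1 !exprS exprD.
  set j1 := ipoch _ _ _; set j2 := ipoch _ _ _.
  by move: (q ^+ n) (q ^+ r) qr0 => x z z0; field; rewrite q0 z0.
case: r => [|r] //.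
rewrite sum_base_change_bailey_small // (@ipoch_small _ _ 0 r.+1) //.
by rewrite !mulr0 mul0r.
Qed.

(** * An alternating sum of Gaussian coefficients *)

(** The summand of [sum_gauss_alternating] as a hypergeometric term. *)
Definition alternating_term (K : fieldType) (q : K) m j : K :=
  q ^+ 'C((m - j).+1, 2) * qpoch q q (m + j) * ipoch q m j
  * ipoch (q ^+ 2) j 0.

(** The sum does not depend on m: the difference of the summands for m+1 and m
    telescopes. *)
Lemma sum_alternating_term (K : fieldType) (q : K) m : generic q ->
  \sum_(0 <= j < m.+1) alternating_term q m j = 1.
Proof.
move=> hq; have [q0 _] := hq.
elim: m => [|m IHm].
  by rewrite big_nat1 /alternating_term /= ipochnn qpoch0 ipochnn expr0 !mulr1.
rewrite -[RHS]IHm; apply/eqP; rewrite -subr_eq0; apply/eqP.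
have -> : \sum_(0 <= j < m.+1) alternating_term q m j
    = \sum_(0 <= j < m.+2) alternating_term q m j.
  rewrite [in RHS]big_nat_recr //= /alternating_term (@ipoch_small _ _ m m.+1) //.
  by rewrite mulr0 mul0r addr0.
rewrite -sumrB.
(* The difference of the summands is G (j + 1) - G j. *)
pose G j := - (q ^+ 'C(m.+2 - j, 2) * qpoch q q (m + j)
  * ipoch q m.+1 j * ipoch (q ^+ 2) j 1).
rewrite big_nat (eq_bigr (fun j => G j.+1 - G j)) => [|j /andP [_ lt_jm]].
  rewrite -big_nat telescope_sumr // /G (@ipoch_small _ _ 0 1) // mulr0 oppr0 subr0.
  by rewrite (@ipoch_small _ _ m.+1 m.+2) // mulr0 mul0r oppr0.
rewrite /alternating_term /G addSn addnS !subSS ipochSS qpochS.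
rewrite (@ipochSr _ (q ^+ 2) j 0); last exact: generic_sqr.
rewrite expr0 divr1 -exprS (exprAC q 2).
have := lt_jm; rewrite ltnS leq_eqVlt => /orP [/eqP -> {lt_jm}|lt_jm'].
  rewrite ipochnn (@ipoch_small _ _ m m.+1) // subSnn subnn.
  rewrite addnS qpochS -exprS -exprM.
  have -> : (m.+1 * 2 = (m + m).+2)%N by lia.
  by ring.
rewrite !subSn // (binS (m - j).+1) bin1 exprD (@ipochSl _ _ m j) //.
have -> : q ^+ (m + j).+1 = q ^+ (m - j).+1 * (q ^+ j) ^+ 2.
  by rewrite -exprM -exprD; congr (_ ^+ _); lia.
have -> : q ^+ m.+1 / q ^+ j = q ^+ (m - j).+1.
  by rewrite -subSn // -{1}(subnK (ltnW lt_jm')) exprD mulfK // expf_neq0.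
set c := q ^+ 'C(_, _); set u := q ^+ _; set j1 := ipoch _ _ _.
by move: (q ^+ j) => y; ring.
Qed.

Lemma sum_gauss_alternating_generic (K : fieldType) (q : K) m : generic q ->
  \sum_(j < m.+1)
     q ^+ 'C((m - j).+1, 2) * gauss q (m + j) (2 * j) * qpoch q (q ^+ 2) j = 1.
Proof.
move=> hq; rewrite -(sum_alternating_term m hq) big_mkord; apply: eq_bigr => j _.
rewrite /alternating_term -!mulrA; congr (_ * _).
rewrite gauss_even // -mulrA (@eq_ipoch _ _ (m + j) _ m j) //; lia.
Qed.

(** * Bailey pairs *)

(** Bailey pairs relative to a = q, up to a constant factor 1 - q, and only up
    to index N: existence of the first member is then a finite induction. *)
Definition bailey_pair (K : fieldType) (q : K) (N : nat) (a b : nat -> K) :=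
  forall n, (n <= N)%N ->
    b n = \sum_(r < n.+1) a r * (ipoch q n r * ipoch q (n + r).+1 0).

Definition bailey_step (K : fieldType) (q : K) (b : nat -> K) (n : nat) : K :=
  \sum_(k < n.+1) q ^+ (k ^ 2 + k) * ipoch q n k * b k.

(** The defining matrix is triangular with nonzero diagonal, so any sequence is
    the second member of a Bailey pair. *)
Lemma bailey_pair_exists (K : fieldType) (q : K) N (b : nat -> K) : generic q ->
  exists a, bailey_pair q N a b.
Proof.
move=> hq; elim: N => [|N [a Ha]].
  exists (fun=> (1 - q) * b 0); case=> [|n] // _.
  rewrite big_ord1 ipochnn mul1r /ipoch /= /qpoch big_ord1 mulr1.
  by rewrite mulrAC divff ?mul1r //; exact: (generic_subr_neq0 0 hq).
pose c := \sum_(r < N.+1) a r * (ipoch q N.+1 r * ipoch q (N.+1 + r).+1 0).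
(* The new entry solves the equation for n = N + 1, in which its coefficient
   is 1 / (q)_(2N+3). *)
exists (fun r => if r == N.+1 then
                   (b N.+1 - c) * qpoch q q (N.+1 + N.+1).+1 else a r).
move=> n; rewrite leq_eqVlt => /orP [/eqP -> | lt_nN].
  rewrite big_ord_recr /= eqxx ipochnn mul1r /ipoch subn0 /= mulfK; last first.
    exact: generic_qpoch_neq0.
  rewrite (eq_bigr (fun r : 'I_N.+1 =>
    a r * (ipoch q N.+1 r * ipoch q (N.+1 + r).+1 0))) => [|r _].
    by rewrite -/c addrC subrK.
  by rewrite (ltn_eqF (ltn_ord r)).
rewrite (Ha n lt_nN); apply: eq_bigr => r _.
by rewrite (@ltn_eqF r) //; apply: leq_ltn_trans lt_nN; rewrite -ltnS.
Qed.

(** The limit of the q-Vandermonde sum in which one Gaussian coefficient becomes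
    1 / (q)_(j+c).  By Pascal's rule the sum for d+1, c equals the sum for
    d, c+1. *)
Lemma sum_vandermonde (K : fieldType) (q : K) d c : generic q ->
  \sum_(j < d.+1) q ^+ (j * (j + c)) * (gauss q d j * ipoch q (j + c) 0)
  = ipoch q (d + c) 0.
Proof.
move=> hq; elim: d c => [|d IHd] c.
  by rewrite big_ord1 mul0n expr0 !mul1r.
rewrite addSnnS -IHd big_ord_recl mul0n expr0 mul1r gauss0r mul1r.
rewrite (eq_bigr (fun j : 'I_d.+1 =>
    q ^+ (j.+1 * (j.+1 + c)) * (gauss q d j * ipoch q (j + c.+1) 0)
  + q ^+ (j.+1 * (j.+1 + c.+1)) * (gauss q d j.+1 * ipoch q (j.+1 + c) 0)));
  last first.
  move=> j _; rewrite lift0 gaussSS -(addSnnS j c) (addnS j.+1) mulnSr exprD.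
  by ring.
rewrite big_split /= addrCA.
have -> : ipoch q (0 + c) 0 + \sum_(j < d.+1)
      q ^+ (j.+1 * (j.+1 + c.+1)) * (gauss q d j.+1 * ipoch q (j.+1 + c) 0)
    = \sum_(j < d.+2)
      q ^+ (j * (j + c.+1)) * (gauss q d j * ipoch q (j + c) 0).
  by rewrite [in RHS]big_ord_recl mul0n expr0 gauss0r !mul1r.
rewrite [X in _ + X]big_ord_recr /= (@gauss_small _ _ d d.+1) //.
rewrite mul0r mulr0 addr0 -big_split.
apply: eq_bigr => j _ /=; rewrite (@ipochSl _ _ (j + c) 0) // expr0 divr1 addnS.
have -> : (j.+1 * (j.+1 + c) = j * (j + c).+1 + (j + c).+1)%N by lia.
by rewrite exprD; ring.
Qed.

(** The limiting case of Bailey's lemma: exchanging the sums reduces the claim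
    to [sum_vandermonde] with d = n - r and c = 2r + 1. *)
Lemma bailey_pair_step (K : fieldType) (q : K) N a b : generic q ->
  bailey_pair q N a b ->
  bailey_pair q N (fun r => q ^+ (r ^ 2 + r) * a r) (bailey_step q b).
Proof.
move=> hq Hab n le_nN; rewrite /bailey_step.
transitivity (\sum_(k < n.+1) \sum_(r < n.+1)
  q ^+ (k ^ 2 + k) * ipoch q n k
   * (a r * (ipoch q k r * ipoch q (k + r).+1 0))).
  apply: eq_bigr => k _; rewrite -mulr_sumr; congr (_ * _).
  have le_kn : (k <= n)%N by rewrite -ltnS.
  rewrite (Hab _ (leq_trans le_kn le_nN)).
  apply: (sum_widen
    (u := fun r => a r * (ipoch q k r * ipoch q (k + r).+1 0))) => // r lt_kr.
  by rewrite ipoch_small // mul0r mulr0.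
rewrite exchange_big; apply: eq_bigr => r _ /=.
have le_rn : (r <= n)%N by rewrite -ltnS.
suff S : \sum_(k < n.+1) q ^+ (k ^ 2 + k)
      * (ipoch q n k * ipoch q k r * ipoch q (k + r).+1 0)
    = q ^+ (r ^ 2 + r) * (ipoch q n r * ipoch q (n + r).+1 0).
  rewrite -[RHS]mulrA [in RHS]mulrCA -S mulr_sumr.
  by apply: eq_bigr => k _; ring.
case: r le_rn => r /= _ le_rn.
have En : n = (r + (n - r))%N by rewrite subnKC.
move: (n - r)%N En => d -> {n le_nN le_rn}.
rewrite -addnS -(big_mkord xpredT (fun k => q ^+ (k ^ 2 + k)
  * (ipoch q (r + d) k * ipoch q k r * ipoch q (k + r).+1 0))).
rewrite (big_cat_nat (n := r)) ?leq_addr //=.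
rewrite big_nat big1 ?add0r => [|k /andP [_ lt_kr]]; last first.
  by rewrite (@ipoch_small _ _ k r) // mulr0 mul0r mulr0.
rewrite -{1}[r]add0n big_addn addKn big_mkord.
have -> : (r + d + r).+1 = (d + (2 * r).+1)%N by lia.
rewrite -sum_vandermonde // (@eq_ipoch _ _ _ r d 0); last by lia.
rewrite !mulr_sumr; apply: eq_bigr => j _.
have -> : ((j + r) ^ 2 + (j + r) = (r ^ 2 + r) + j * (j + (2 * r).+1))%N.
  by rewrite !expnS !expn0; nia.
have -> : (j + r + r).+1 = (j + (2 * r).+1)%N by lia.
rewrite exprD gauss_ipoch // (@eq_ipoch _ _ (r + d) (j + r) d j); last by lia.
rewrite (@eq_ipoch _ _ (j + r) r j 0); last by lia.
have -> : ipoch q d 0 = (qpoch q q d)^-1 by rewrite /ipoch subn0.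
by field; apply: generic_qpoch_neq0.
Qed.

(** [base_change] acts on chains; the extra factors translate between chains and
    second members of Bailey pairs, see [lhs_beta] and [rhs_beta]. *)
Definition base_change_seq (K : fieldType) (q : K) (b : nat -> K) (n : nat) :=
  \sum_(k < n.+1) base_change q n k
     * (qpoch (- q) q (2 * k + 1) * qpoch (q ^+ 2) (q ^+ 2) k * b k)
  / (q ^+ 'C(n.+1, 2) * qpoch (q ^+ 2) (q ^+ 2) n).

Lemma base_changeE (K : fieldType) (q : K) n k : generic q -> (k <= n)%N ->
  base_change q n k * qpoch (q ^+ 2) (q ^+ 2) k
  = qpoch q q n.+1 * base_change_entry q n k.
Proof.
move=> hq le_kn; have [q0 _] := hq.
rewrite /base_change le_kn -wsignE // -[_ * _ * qpoch q _ _]mulrA gauss_even //.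
rewrite /base_change_entry (@eq_ipoch _ _ n.+1 _ (2 * k + 1) n); last by lia.
by rewrite (@eq_ipoch _ _ (n - k) 0 n k) ?subnK //; ring.
Qed.

(** [sum_base_change_bailey], summed against the first member of the pair. *)
Lemma bailey_pair_base_change (K : fieldType) (q : K) N a b : generic q ->
  bailey_pair (q ^+ 2) N a b ->
  bailey_pair q N (fun r => a r / q ^+ 'C(r.+1, 2)) (base_change_seq q b).
Proof.
move=> hq Hab n le_nN; rewrite /base_change_seq; have [q0 _] := hq.
transitivity (\sum_(k < n.+1) \sum_(r < n.+1)
   a r * (qpoch q q n.+1 / (q ^+ 'C(n.+1, 2) * qpoch (q ^+ 2) (q ^+ 2) n)
     * base_change_bailey_term q n r k)).
  apply: eq_bigr => k _.
  have le_kn : (k <= n)%N by rewrite -ltnS.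
  rewrite (Hab _ (leq_trans le_kn le_nN)).
  rewrite (sum_widen (u := fun r => a r
      * (ipoch (q ^+ 2) k r * ipoch (q ^+ 2) (k + r).+1 0))
      (le_kn : (k < n.+1)%N)).
    rewrite !mulr_sumr mulr_suml; apply: eq_bigr => r _.
    transitivity (base_change q n k * qpoch (q ^+ 2) (q ^+ 2) k
      * (qpoch (- q) q (2 * k + 1)
         * (a r * (ipoch (q ^+ 2) k r * ipoch (q ^+ 2) (k + r).+1 0))
         / (q ^+ 'C(n.+1, 2) * qpoch (q ^+ 2) (q ^+ 2) n))); first by ring.
    by rewrite base_changeE // /base_change_bailey_term (addn1 (k + r)); ring.
  by move=> r lt_kr; rewrite ipoch_small // mul0r mulr0.
rewrite exchange_big; apply: eq_bigr => r _ /=.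
rewrite -mulr_sumr -mulrA; congr (_ * _).
rewrite -mulr_sumr -(big_mkord xpredT (base_change_bailey_term q n r)).
have nzr : q ^+ 'C(r.+1, 2) != 0 by rewrite expf_neq0.
apply: (mulfI nzr); rewrite mulVKf // qpochS -exprS.
have := sum_base_change_bailey n r hq; set S := \sum_(_ <= _ < _) _ => ES.
transitivity (qpoch q q n / (q ^+ 'C(n.+1, 2) * qpoch (q ^+ 2) (q ^+ 2) n)
  * ((1 - q ^+ n.+1) * q ^+ 'C(r.+1, 2) * S)); first by ring.
rewrite ES qpoch_sqr; field.
by rewrite expf_neq0 // generic_qpochN_neq0 // generic_qpoch_neq0.
Qed.

(** On the first member, both sides multiply by q^(2(r^2+r) - r(r+1)/2). *)
Lemma base_change_seq_step (K : fieldType) (q : K) (b : nat -> K) n :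
  generic q ->
  base_change_seq q (bailey_step (q ^+ 2) b) n
  = bailey_step q (bailey_step q (base_change_seq q b)) n.
Proof.
move=> hq; have [a Ha] := bailey_pair_exists n b (generic_sqr hq).
have H1 := bailey_pair_base_change hq
  (bailey_pair_step (generic_sqr hq) Ha).
have H2 := bailey_pair_step hq
  (bailey_pair_step hq (bailey_pair_base_change hq Ha)).
rewrite H1 // H2 //; apply: eq_bigr => r _; congr (_ * _).
by rewrite -exprM mulnC exprM expr2; ring.
Qed.

(** * Chains as Bailey pairs *)

Definition lhs_beta (K : fieldType) (q : K) l n : K :=
  lhs_chain q l n / qpoch (q ^+ 2) (q ^+ 2) n.

Definition rhs_beta (K : fieldType) (q : K) l n : K :=
  rhs_chain q l n / (qpoch (- q) q (2 * n + 1) * qpoch (q ^+ 2) (q ^+ 2) n).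

Lemma lhs_betaS (K : fieldType) (q : K) l n : generic q ->
  lhs_beta q l.+1 n = bailey_step q (lhs_beta q l) n.
Proof.
move=> hq; rewrite /lhs_beta /lhs_chain /= /bailey_step mulr_suml.
apply: eq_bigr => k _; have le_kn : (k <= n)%N by rewrite -ltnS.
rewrite /lhs_kernel gauss_ipoch // !qpoch_sqr.
have -> : qpoch (- q) q n
    = qpoch (- q) q k * qpoch (- q ^+ (k + 1)) q (n - k).
  by rewrite -{1}(subnKC le_kn) qpochD mulNr -exprS addn1.
have -> : ipoch q k 0 = (qpoch q q k)^-1 by rewrite /ipoch subn0.
have := generic_qpochN_neq0 n hq; rewrite -{1}(subnKC le_kn) qpochD.
rewrite mulNr -exprS -(addn1 k) mulf_eq0 negb_or => /andP [nz1 nz2].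
field; rewrite nz1 nz2 !generic_qpoch_neq0 //.
Qed.

Lemma rhs_betaS (K : fieldType) (q : K) l n : generic q ->
  rhs_beta q l.+1 n = bailey_step (q ^+ 2) (rhs_beta q l) n.
Proof.
move=> hq; have hq2 := generic_sqr hq.
rewrite /rhs_beta /rhs_chain /= /bailey_step mulr_suml.
apply: eq_bigr => k _; have le_kn : (k <= n)%N by rewrite -ltnS.
rewrite /rhs_kernel gauss_ipoch // -exprM mulnDr.
have E2 : (2 * n + 1 = (2 * k + 1) + (2 * n - 2 * k))%N by lia.
have E : qpoch (- q) q (2 * n + 1)
    = qpoch (- q) q (2 * k + 1) * qpoch (- q ^+ (2 * k + 2)) q (2 * n - 2 * k).
  by rewrite E2 qpochD mulNr -exprS addn1 addn2.
have -> : ipoch (q ^+ 2) k 0 = (qpoch (q ^+ 2) (q ^+ 2) k)^-1.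
  by rewrite /ipoch subn0.
have := generic_qpochN_neq0 (2 * n + 1) hq; rewrite E.
rewrite mulf_eq0 negb_or => /andP [nz1 nz2].
field; rewrite nz1 nz2 !generic_qpoch_neq0 //.
Qed.

(** One step on the right is exchanged for two on the left at each induction
    step; the bottoms correspond by [sum_base_change_entry]. *)
Lemma rhs_lhs_beta (K : fieldType) (q : K) i n : generic q ->
  base_change_seq q (rhs_beta q i) n = lhs_beta q (2 * i) n.
Proof.
move=> hq; have hq2 := generic_sqr hq; have [q0 _] := hq.
elim: i n => [|i IHi] n.
  rewrite /base_change_seq /lhs_beta /lhs_chain /=.
  transitivity (qpoch q q n * ((1 - q ^+ n.+1)
      * \sum_(0 <= k < n.+1) base_change_entry q n k)
      / (q ^+ 'C(n.+1, 2) * qpoch (q ^+ 2) (q ^+ 2) n)).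
    rewrite big_mkord !mulr_sumr mulr_suml; apply: eq_bigr => k _.
    have le_kn : (k <= n)%N by rewrite -ltnS.
    congr (_ / _); rewrite /rhs_beta /rhs_chain /= invfM.
    transitivity (base_change q n k * qpoch (q ^+ 2) (q ^+ 2) k).
      by field; rewrite generic_qpochN_neq0 // generic_qpoch_neq0.
    by rewrite base_changeE // qpochS -exprS; ring.
  rewrite sum_base_change_entry //; field.
  by rewrite generic_qpoch_neq0 // expf_neq0.
have -> : (2 * i.+1 = (2 * i).+2)%N by lia.
rewrite lhs_betaS //; transitivity (base_change_seq q
  (bailey_step (q ^+ 2) (rhs_beta q i)) n).
  rewrite /base_change_seq; apply: eq_bigr => k _.
  by rewrite rhs_betaS.
rewrite base_change_seq_step //; apply: eq_bigr => k _; congr (_ * _).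
by rewrite lhs_betaS //; apply: eq_bigr => j _; rewrite IHi.
Qed.

Lemma chain_base_change_generic (K : fieldType) (q : K) i n : generic q ->
  q ^+ 'C(n.+1, 2) * lhs_chain q (2 * i) n
  = \sum_(k < n.+1) base_change q n k * rhs_chain q i k.
Proof.
move=> hq; have hq2 := generic_sqr hq; have [q0 _] := hq.
have := rhs_lhs_beta i n hq; rewrite /base_change_seq /lhs_beta -mulr_suml.
move/(congr1 (fun x => x * (q ^+ 'C(n.+1, 2) * qpoch (q ^+ 2) (q ^+ 2) n))).
rewrite mulfVK; last by rewrite mulf_neq0 ?expf_neq0 ?generic_qpoch_neq0.
move=> E; rewrite [LHS](_ : _ =
    lhs_chain q (2 * i) n / qpoch (q ^+ 2) (q ^+ 2) n *
    (q ^+ 'C(n.+1, 2) * qpoch (q ^+ 2) (q ^+ 2) n)); last first.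
  by field; rewrite generic_qpoch_neq0.
rewrite -E; apply: eq_bigr => k _; congr (_ * _).
rewrite /rhs_beta mulrC mulfVK // mulf_neq0 ?generic_qpoch_neq0 //.
exact: generic_qpochN_neq0.
Qed.

(** * From generic q to all q *)

Lemma generic_tofracX (F : fieldType) : generic (@FracField.tofrac {poly F} 'X).
Proof.
split=> [|n]; first by rewrite tofrac_eq0 polyX_eq0.
rewrite -tofracXn -tofrac1 tofrac_eq.
apply/eqP => /(congr1 (fun p : {poly F} => size p)).
by rewrite size_polyXn size_poly1.
Qed.

(** The indeterminate is generic in the fraction field of polynomials, which
    contains the polynomials; and polynomials can be evaluated anywhere.  An
    identity between expressions natural in q therefore need only be proved for
    generic q. *)
Lemma polyX_transfer (F : fieldType) (u v : forall A : comNzRingType, A -> A)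
    (q : F) :
  (forall (A B : comNzRingType) (f : {rmorphism A -> B}) x,
     f (u A x) = u B (f x)) ->
  (forall (A B : comNzRingType) (f : {rmorphism A -> B}) x,
     f (v A x) = v B (f x)) ->
  (forall (K : fieldType) (x : K), generic x -> u K x = v K x) ->
  u F q = v F q.
Proof.
move=> fu fv uv.
have uvX : u {poly F} 'X = v {poly F} 'X.
  apply/eqP; rewrite -tofrac_eq (fu _ _ (@FracField.tofrac {poly F})).
  by rewrite (fv _ _ (@FracField.tofrac {poly F})) (uv _ _ (generic_tofracX F)).
have := congr1 (horner_eval q) uvX.
by rewrite fu fv /= /horner_eval hornerX.
Qed.

(** Commutation of the change of base with the steps of the two chains, freed
    from denominators. *)
Lemma chain_base_change (F : fieldType) (q : F) i n :
  q ^+ 'C(n.+1, 2) * lhs_chain q (2 * i) n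
  = \sum_(k < n.+1) base_change q n k * rhs_chain q i k.
Proof.
apply: (polyX_transfer
  (u := fun A x => x ^+ 'C(n.+1, 2) * lhs_chain x (2 * i) n)
  (v := fun A x => \sum_(k < n.+1) base_change x n k * rhs_chain x i k)).
- by move=> A B f x; rewrite rmorphM rmorphXn rmorph_lhs_chain.
- move=> A B f x; rewrite rmorph_sum; apply: eq_bigr => k _.
  by rewrite rmorphM rmorph_base_change rmorph_rhs_chain.
- by move=> K x; exact: chain_base_change_generic.
Qed.

Lemma sum_gauss_alternating (F : fieldType) (q : F) m :
  \sum_(j < m.+1)
     q ^+ 'C((m - j).+1, 2) * gauss q (m + j) (2 * j) * qpoch q (q ^+ 2) j = 1.
Proof.
apply: (polyX_transfer
  (u := fun A x => \sum_(j < m.+1)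
     x ^+ 'C((m - j).+1, 2) * gauss x (m + j) (2 * j) * qpoch x (x ^+ 2) j)
  (v := fun A x => 1)).
- move=> A B f x; rewrite rmorph_sum; apply: eq_bigr => j _.
  by rewrite !rmorphM rmorphXn rmorph_gauss rmorph_qpoch rmorphXn.
- by move=> A B f x; rewrite rmorph1.
- by move=> K x; exact: sum_gauss_alternating_generic.
Qed.

(** * Vanishing at roots of unity *)

Lemma qpoch_eq0 (A : comNzRingType) (a q : A) n i :
  (i < n)%N -> a * q ^+ i = 1 -> qpoch a q n = 0.
Proof.
move=> lt_in aq1; rewrite /qpoch (bigD1 (Ordinal lt_in)) //= aq1 subrr.
exact: mul0r.
Qed.

Lemma prim_qpoch_eq0 (F : fieldType) (q : F) N n :
  N.-primitive_root q -> (N <= n)%N -> qpoch q q n = 0.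
Proof.
move=> hq le_Nn; have N0 := prim_order_gt0 hq.
apply: (@qpoch_eq0 _ _ _ _ N.-1); first by rewrite prednK.
by rewrite -exprS prednK // prim_expr_order.
Qed.

Lemma prim_qpoch_neq0 (F : fieldType) (q : F) N n :
  N.-primitive_root q -> (n < N)%N -> qpoch q q n != 0.
Proof.
move=> hq lt_nN; apply/prodf_neq0 => i _.
rewrite -exprS subr_eq0 eq_sym -(prim_order_dvd hq) gtnNdvd //.
exact: leq_ltn_trans lt_nN.
Qed.

Lemma prim_gauss_eq0 (F : fieldType) (q : F) N n k :
  N.-primitive_root q -> (k < N)%N -> (N <= n)%N -> (n < N + k)%N ->
  gauss q n k = 0.
Proof.
move=> hq lt_kN le_Nn lt_nNk.
have := gauss_qpoch q (n - k) k; rewrite subnK; last by lia.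
rewrite (prim_qpoch_eq0 hq le_Nn) => /eqP; rewrite mulf_eq0 => /orP [/eqP //|].
rewrite mulf_eq0 !(negbTE (prim_qpoch_neq0 hq _)) //; lia.
Qed.

(** For odd N, q^2 is also a primitive N-th root of unity, so for j = n - k < N
    the denominators (q)_(n+1-2j) and (q^2;q^2)_j are nonzero while (q)_(n+1)
    vanishes.  The remaining case j = N forces n + 1 = 2N, and the factor
    1 - q^N of (q;q^2)_N vanishes. *)
Lemma odd_prim_base_change_eq0 (F : fieldType) (q : F) N n k :
  N.-primitive_root q -> odd N -> (k < N)%N -> (N <= n)%N ->
  base_change q n k = 0.
Proof.
move=> hq oddN lt_kN le_Nn; rewrite /base_change; case: ifP => // le_kn.
have -> : n = (k + (n - k))%N by rewrite subnKC.
rewrite addKn; have : (N <= k + (n - k))%N by rewrite subnKC.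
move: (n - k)%N => j {le_Nn le_kn n} le_Nn.
have [lt_n2j|le_2jn] := ltnP (k + j).+1 (2 * j).
  by rewrite gauss_small // mulr0 mul0r.
rewrite -mulrA; apply/eqP; rewrite mulf_eq0; apply/orP; right.
have [le_Nj|lt_jN] := leqP N j.
  rewrite (@qpoch_eq0 _ _ _ _ N./2) ?mulr0 //; first by lia.
  by rewrite -exprM -exprS -(prim_expr_order hq); congr (_ ^+ _); lia.
have nzQ : qpoch (q ^+ 2) (q ^+ 2) j != 0.
  apply/prodf_neq0 => i _; rewrite -exprS -exprM subr_eq0 eq_sym.
  rewrite -(prim_order_dvd hq) Gauss_dvdr ?coprimen2 // gtnNdvd //.
  exact: leq_ltn_trans lt_jN.
rewrite -(inj_eq (mulIf nzQ)) mul0r -mulrA -qpoch_double.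
have := gauss_qpoch q ((k + j).+1 - 2 * j) (2 * j); rewrite subnK // => E.
have lt1 : ((k + j).+1 - 2 * j < N)%N by lia.
rewrite -(inj_eq (mulIf (prim_qpoch_neq0 hq lt1))) mul0r.
by rewrite -mulrA [X in _ * X]mulrC E (prim_qpoch_eq0 hq) //; lia.
Qed.

Lemma prim_half (F : fieldType) (q : F) h :
  (2 * h).-primitive_root q -> q ^+ h = -1.
Proof.
move=> hq; have := prim_order_gt0 hq; rewrite muln_gt0 /= => h0.
have : (q ^+ h) ^+ 2 == 1 by rewrite -exprM mulnC (prim_expr_order hq).
rewrite sqrf_eq1 => /orP [|/eqP //].
by rewrite -(prim_order_dvd hq) gtnNdvd //; lia.
Qed.

(** Odd multiples of h are exponents at which q takes the value -1. *)
Lemma even_prim_qpoch_eq0 (F : fieldType) (q : F) h a n e :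
  (2 * h).-primitive_root q -> odd e ->
  (a <= e * h)%N -> (e * h < a + n)%N -> qpoch (- q ^+ a) q n = 0.
Proof.
move=> hq odde le_ah lt_han; apply: (@qpoch_eq0 _ _ _ _ (e * h - a)); first by lia.
rewrite mulNr -exprD subnKC // mulnC exprM (prim_half hq).
by rewrite -signr_odd odde expr1 opprK.
Qed.

(** In each step from k < N to n >= N, the Gaussian coefficient vanishes unless
    n >= N + k, and then the range of exponents k+1, ..., n contains N/2
    (if k < N/2) or 3N/2. *)
Lemma even_prim_lhs_chain_eq0 (F : fieldType) (q : F) h l n :
  (2 * h).-primitive_root q -> (2 * h <= n)%N -> lhs_chain q l n = 0.
Proof.
move=> hq; elim: l n => [|l IHl] n le_hn; first exact: prim_qpoch_eq0 hq le_hn.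
rewrite /lhs_chain /=; apply: big1 => k _.
have [le_hk|lt_kh] := leqP (2 * h) k.
  by rewrite -/(lhs_chain q l k) IHl // mulr0.
suff -> : lhs_kernel q n k = 0 by rewrite mul0r.
rewrite /lhs_kernel.
have [lt_n|le_n] := ltnP n (2 * h + k).
  by rewrite (prim_gauss_eq0 hq) // mulr0 mul0r.
have [lt_k|le_k] := ltnP k h.
  by rewrite (even_prim_qpoch_eq0 (e := 1) hq) ?mulr0 //; lia.
by rewrite (even_prim_qpoch_eq0 (e := 3) hq) ?mulr0 //; lia.
Qed.

(** A step from 2k+1 < 3N/2 to 2n+1 >= 3N/2 has a factor 1 + q^(3N/2) = 0.  The
    hypothesis admits some n < N, because the step needs 2k+2 <= 3N/2 for every
    k that the induction hypothesis leaves out. *)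
Lemma even_prim_rhs_chain_eq0 (F : fieldType) (q : F) h l n :
  (2 * h).-primitive_root q -> (3 * h <= 2 * n + 1)%N -> rhs_chain q l n = 0.
Proof.
move=> hq; have := prim_order_gt0 hq; rewrite muln_gt0 /= => h0.
elim: l n => [|l IHl] n le_hn.
  apply: (@qpoch_eq0 _ _ _ _ h.-1); first by lia.
  by rewrite -exprS prednK // -exprM (prim_expr_order hq).
rewrite /rhs_chain /=; apply: big1 => k _.
have [le_hk|lt_kh] := leqP (3 * h) (2 * k + 1).
  by rewrite -/(rhs_chain q l k) IHl // mulr0.
by rewrite /rhs_kernel (even_prim_qpoch_eq0 (e := 3) hq) ?mulr0 ?mul0r //; lia.
Qed.

(** * Summation over the last index *)

Lemma bin2_double n : (2 * 'C(n, 2) = n * n.-1)%N.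
Proof. by rewrite -mul_bin_diag bin1. Qed.

(** For n = k + j, the weighted entry is (-1)^k q^(-(k+1)^2) times the summand of
    [sum_gauss_alternating] for m = k + 1; the entries with j > k + 1 are zero. *)
Lemma sum_base_change_alternating (F : fieldType) (q : F) L k :
  q != 0 -> (2 * k + 2 <= L)%N ->
  \sum_(n < L) (-1) ^+ n / q ^+ 'C(n.+1, 2) * base_change q n k
  = (-1) ^+ k / q ^+ ((k + 1) ^ 2).
Proof.
move=> q0 le_kL.
rewrite -(big_mkord xpredT (fun n => (-1) ^+ n / q ^+ 'C(n.+1, 2)
   * base_change q n k)).
rewrite (big_cat_nat (n := k)) //=; last by lia.
rewrite big_nat big1 ?add0r => [|n /andP [_ lt_nk]]; last first.
  by rewrite /base_change leqNgt lt_nk mulr0.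
rewrite -{1}[k]add0n big_addn big_mkord.
rewrite -(@sum_widen _ (fun j => (-1) ^+ (j + k) / q ^+ 'C((j + k).+1, 2)
   * base_change q (j + k) k) k.+2); first last.
- move=> j le_kj; rewrite /base_change leq_addl addnK.
  by rewrite gauss_small ?mulr0 ?mul0r ?mulr0 //; lia.
- by lia.
rewrite -[RHS]mulr1 -[X in _ = _ * X](sum_gauss_alternating q k.+1) mulr_sumr.
apply: eq_bigr => j _; have le_jk : (j <= k.+1)%N by rewrite -ltnS.
rewrite /base_change leq_addl addnK addSn (addnC k j) addn1 exprD.
have sgn : (-1) ^+ j * (-1) ^+ j = 1 :> F by rewrite -exprMn mulrNN mulr1 expr1n.
have nz e : q ^+ e != 0 by rewrite expf_neq0.
have E : q ^+ (j * j.-1) * q ^+ (k.+1 ^ 2)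
       = q ^+ 'C((k.+1 - j).+1, 2) * q ^+ 'C((j + k).+1, 2).
  rewrite -!exprD; congr (_ ^+ _).
  have := bin2_double (k.+1 - j).+1; have := bin2_double (j + k).+1.
  rewrite /= expnS expn1; nia.
have {}E : q ^+ (j * j.-1) / q ^+ 'C((j + k).+1, 2)
         = q ^+ 'C((k.+1 - j).+1, 2) / q ^+ (k.+1 ^ 2).
  by apply/eqP; rewrite eqr_div // E.
transitivity (((-1) ^+ j * (-1) ^+ j)
  * (q ^+ (j * j.-1) / q ^+ 'C((j + k).+1, 2)) * (-1) ^+ k
  * (gauss q (j + k).+1 (2 * j) * qpoch q (q ^+ 2) j)); first by ring.
by rewrite sgn E; ring.
Qed.

(** The double sum over k <= n < N contains truncated columns, whereas column
    sums are only known over n < 2N.  For odd N the part N <= n of each column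
    k < N is zero; for even N both chains are zero from N on, so the double sum
    may be cut off at 2N. *)
Lemma sum_lhs_rhs_chain (F : fieldType) (q : F) N i :
  N.-primitive_root q ->
  \sum_(n < N) (-1) ^+ n * lhs_chain q (2 * i) n
  = \sum_(k < N) (-1) ^+ k / q ^+ ((k + 1) ^ 2) * rhs_chain q i k.
Proof.
move=> hq; have N0 := prim_order_gt0 hq.
have q0 : q != 0 by rewrite (prim_root_eq0 hq) -lt0n.
pose c n k := (-1) ^+ n / q ^+ 'C(n.+1, 2) * base_change q n k.
have swap M : \sum_(n < M) (-1) ^+ n * lhs_chain q (2 * i) n
    = \sum_(k < M) (\sum_(n < M) c n k) * rhs_chain q i k.
  transitivity (\sum_(n < M) \sum_(k < M) c n k * rhs_chain q i k).
    apply: eq_bigr => n _.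
    rewrite -(@sum_widen _ (fun k => c n k * rhs_chain q i k) n.+1) //.
      rewrite /c; transitivity ((-1) ^+ n / q ^+ 'C(n.+1, 2)
        * (q ^+ 'C(n.+1, 2) * lhs_chain q (2 * i) n)).
        by rewrite mulrA mulfVK // expf_neq0.
      by rewrite chain_base_change mulr_sumr; apply: eq_bigr => k _; rewrite mulrA.
    by move=> k lt_nk; rewrite /c /base_change leqNgt lt_nk mulr0 mul0r.
  by rewrite exchange_big; apply: eq_bigr => k _ /=; rewrite mulr_suml.
(* For k < N, the support of column k ends at 2k + 1 < 2N. *)
have closed (k : 'I_N) : \sum_(n < 2 * N) c n k
    = (-1) ^+ k / q ^+ ((k + 1) ^ 2).
  by apply: sum_base_change_alternating => //; have := ltn_ord k; lia.
have [oddN|evenN] := boolP (odd N).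
  rewrite swap; apply: eq_bigr => k _; rewrite -closed; congr (_ * _).
  apply: (@sum_widen _ (fun n => c n k)) => [|n le_Nn]; first by lia.
  by rewrite /c (odd_prim_base_change_eq0 hq) ?mulr0.
have EN : N = (2 * N./2)%N by lia.
rewrite EN in hq.
transitivity (\sum_(n < 2 * N) (-1) ^+ n * lhs_chain q (2 * i) n).
  apply: (@sum_widen _ (fun n => (-1) ^+ n * lhs_chain q (2 * i) n)) => [|n le_Nn].
    by lia.
  by rewrite (even_prim_lhs_chain_eq0 _ hq) ?mulr0 //; lia.
rewrite swap -(@sum_widen _
  (fun k => (\sum_(n < 2 * N) c n k) * rhs_chain q i k) N) ?leq_pmull //.
  by apply: eq_bigr => k _; rewrite closed.
by move=> k le_Nk; rewrite (even_prim_rhs_chain_eq0 _ hq) ?mulr0 //; lia.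
Qed.

(** * Sums over nondecreasing tuples *)

Lemma sum_tuple_cons (A : comNzRingType) (T : finType) l
    (E : l.+1.-tuple T -> A) :
  \sum_(t : l.+1.-tuple T) E t
  = \sum_(x : T) \sum_(t : l.-tuple T) E [tuple of x :: t].
Proof.
rewrite pair_big /= (reindex (fun p : T * l.-tuple T => [tuple of p.1 :: p.2])).
  by [].
exists (fun t => (thead t, [tuple of behead t])) => [[x t] _|t _] /=.
  by rewrite theadE; congr pair; apply: val_inj.
by rewrite [t in RHS]tuple_eta.
Qed.

Lemma part_cons1 N l (x : 'I_N) (t : l.-tuple 'I_N) :
  part [tuple of x :: t] 1 = x.
Proof. by []. Qed.

Lemma part_consS N l (x : 'I_N) (t : l.-tuple 'I_N) i :
  part [tuple of x :: t] i.+2 = part t i.+1.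
Proof. by []. Qed.

Lemma nondecreasing_cons N l (x : 'I_N) (t : l.+1.-tuple 'I_N) :
  nondecreasing_tuple [tuple of x :: t]
  = (x <= part t 1)%N && nondecreasing_tuple t.
Proof. by case/tupleP: t => y t. Qed.

Lemma part_ltn N l (t : l.+1.-tuple 'I_N) i :
  (part t i < N)%N.
Proof.
(* Out of range the entry is 0, and N > 0 since the tuple is not empty. *)
rewrite /part; set s := map _ _.
have [lt_is|le_si] := ltnP i.-1 (size s).
  by have /mapP[x _ ->] := mem_nth 0%N lt_is; apply: ltn_ord.
by rewrite nth_default //; case/tupleP: t @s le_si => x; case: N x => [[]|].
Qed.

(** Removing the smallest entry of the tuple replaces the bottom of the chain by
    the result of its first step. *)
Lemma sum_nondecreasing_chain (A : comNzRingType) N l (h e : nat -> A)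
    (K : nat -> nat -> A) :
  \sum_(t : l.+1.-tuple 'I_N | nondecreasing_tuple t)
     (h (part t 1) * \prod_(1 <= i < l.+1) K (part t i.+1) (part t i)
      * e (part t l.+1))
  = \sum_(n < N) e n * chain h K l n.
Proof.
elim: l h => [|l IHl] h.
  rewrite big_mkcond sum_tuple_cons; apply: eq_bigr => x _.
  rewrite (bigD1 [tuple]) //= [X in _ + X]big1 ?addr0 => [|t]; last first.
    by case/negP; apply/eqP; apply: tuple0.
  by rewrite big_geq // mulr1 mulrC.
under [RHS]eq_bigr do rewrite chainSr.
rewrite big_mkcond sum_tuple_cons exchange_big /=.
rewrite -IHl [RHS]big_mkcond; apply: eq_bigr => t _ /=.
under eq_bigr => x _ do rewrite nondecreasing_cons part_cons1 part_consS.
case: ifP => [nd_t|nd_t]; last by rewrite big1 // => x _; rewrite andbF.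
under eq_bigr => x _ do rewrite andbT.
rewrite !mulr_suml (big_ord_widen N (fun k =>
   K (part t 1) k * h k * \prod_(1 <= i < l.+1) K (part t i.+1) (part t i)
      * e (part t l.+1)) (part_ltn t 1)).
rewrite [RHS]big_mkcond; apply: eq_bigr => x _; rewrite ltnS.
case: ifP => // _; rewrite big_ltn // big_add1 /=; congr (_ * _).
rewrite part_cons1 part_consS mulrA (mulrC (h x)); congr (_ * _).
by apply: eq_big_nat => -[|i].
Qed.

(** Adjacent ranges of exponents concatenate. *)
Lemma qpoch_telescope (A : comNzRingType) (a q : A) (f : nat -> nat) l :
  (forall i, (0 < i <= l)%N -> (f i <= f i.+1)%N) ->
  qpoch (a * q ^+ f 1) q (f l.+1 - f 1)
  = \prod_(1 <= i < l.+1) qpoch (a * q ^+ f i) q (f i.+1 - f i).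
Proof.
move=> f_mono.
suff [le1 ->] : (f 1 <= f l.+1)%N /\
    qpoch (a * q ^+ f 1) q (f l.+1 - f 1)
    = \prod_(1 <= i < l.+1) qpoch (a * q ^+ f i) q (f i.+1 - f i) by [].
elim: l f_mono => [|l IHl] f_mono.
  by rewrite leqnn subnn qpoch0 big_geq.
have [|le1 E] := IHl; first by move=> i hi; apply: f_mono; lia.
have le2 : (f l.+1 <= f l.+2)%N by apply: f_mono; lia.
split; first exact: leq_trans le2.
rewrite big_nat_recr //= -E.
have -> : (f l.+2 - f 1 = (f l.+1 - f 1) + (f l.+2 - f l.+1))%N by lia.
by rewrite qpochD -mulrA -exprD subnKC.
Qed.

Lemma part_leS N l (t : l.+1.-tuple 'I_N) i :
  nondecreasing_tuple t -> (0 < i <= l)%N -> (part t i <= part t i.+1)%N.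
Proof.
move=> nd_t; case: i => // i /andP [_ le_il].
by move/(sortedP 0%N): nd_t; apply; rewrite size_map size_tuple.
Qed.

Lemma sum_tuple_lhs (F : fieldType) (q : F) N l :
  \sum_(t : l.+1.-tuple 'I_N | nondecreasing_tuple t)
     (qpoch (- q ^+ (part t 1 + 1)) q (part t l.+1 - part t 1)
      * (-1) ^+ part t l.+1
      * qpoch q q (part t 1)
      * \prod_(1 <= i < l.+1)
          (q ^+ (part t i ^ 2 + part t i)
           * (qbinom F (part t (i + 1)) (part t i)).[q]))
  = \sum_(n < N) (-1) ^+ n * lhs_chain q l n.
Proof.
rewrite -sum_nondecreasing_chain; apply: eq_bigr => t nd_t.
have := qpoch_telescope (- q) q (fun i hi => part_leS nd_t hi).
rewrite mulNr -exprS -addn1 => ->.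
rewrite -!mulrA mulrCA [RHS]mulrA [RHS]mulrC; congr (_ * _).
rewrite mulrCA; congr (_ * _); rewrite -big_split; apply: eq_bigr => i _ /=.
rewrite /lhs_kernel qbinom_horner mulNr -exprS -addn1 (addn1 i).
exact: mulrC.
Qed.

Lemma sum_tuple_rhs (F : fieldType) (q : F) N l :
  \sum_(t : l.+1.-tuple 'I_N | nondecreasing_tuple t)
     (qpoch (- q ^+ (2 * part t 1 + 2)) q (2 * part t l.+1 - 2 * part t 1)
      * (-1) ^+ part t l.+1
      * q ^- ((part t l.+1 + 1) ^ 2)
      * qpoch (q ^+ 2) (q ^+ 2) (part t 1)
      * \prod_(1 <= i < l.+1)
          (q ^+ (2 * part t i ^ 2 + 2 * part t i)
           * (qbinom F (part t (i + 1)) (part t i)).[q ^+ 2]))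
  = \sum_(n < N) (-1) ^+ n / q ^+ ((n + 1) ^ 2) * rhs_chain q l n.
Proof.
rewrite -(@sum_nondecreasing_chain _ _ _ _
  (fun n => (-1) ^+ n / q ^+ ((n + 1) ^ 2))).
apply: eq_bigr => t nd_t.
have mono i : (0 < i <= l)%N -> (2 * part t i <= 2 * part t i.+1)%N.
  by move=> hi; rewrite leq_mul2l /= part_leS.
have := qpoch_telescope (- q ^+ 2) q mono.
rewrite mulNr -exprD addnC => ->.
rewrite -!mulrA mulrCA [RHS]mulrA [RHS]mulrC -!mulrA; congr (_ * _).
rewrite mulrCA; congr (_ * _).
rewrite mulrCA; congr (_ * _); rewrite -big_split; apply: eq_bigr => i _ /=.
rewrite /rhs_kernel qbinom_horner mulNr -exprD (addnC 2) (addn1 i).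
exact: mulrC.
Qed.

Theorem theorem1p3 (R : realType) (m N : nat) (q : complex R)
    (hm : (1 <= m)%N) (hq : N.-primitive_root q) :
  \sum_(t : (2 * m - 1).-tuple 'I_N | nondecreasing_tuple t)
     (qpoch (- q ^+ (part t 1 + 1)) q (part t (2 * m - 1) - part t 1)
      * (-1) ^+ part t (2 * m - 1)
      * qpoch q q (part t 1)
      * \prod_(1 <= i < 2 * m - 1)
          (q ^+ (part t i ^ 2 + part t i)
           * (qbinom (complex R) (part t (i + 1)) (part t i)).[q]))
  = \sum_(t : m.-tuple 'I_N | nondecreasing_tuple t)
     (qpoch (- q ^+ (2 * part t 1 + 2)) q (2 * part t m - 2 * part t 1)
      * (-1) ^+ part t m
      * q ^- ((part t m + 1) ^ 2)
      * qpoch (q ^+ 2) (q ^+ 2) (part t 1)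
      * \prod_(1 <= i < m)
          (q ^+ (2 * part t i ^ 2 + 2 * part t i)
           * (qbinom (complex R) (part t (i + 1)) (part t i)).[q ^+ 2])).
Proof.
case: m hm => // i _.
have -> : (2 * i.+1 - 1 = (2 * i).+1)%N by lia.
by rewrite sum_tuple_lhs sum_tuple_rhs; exact: sum_lhs_rhs_chain.
Qed.
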